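(* Let $n\in\mathbb{N}$, let $T,U=(U_1,\ldots,U_n)$ be parameters and $X_1,\ldots,X_n$ variables, and let $G_i:=X_i^2-X_i$ for $1\le i\le n$ and $$F_n:=\sum_{i=1}^n2^{i-1}X_i+T\prod_{i=1}^n\bigl(1+(U_i-1)X_i\bigr)\in\mathbb{Q}[T,U,X_1,\ldots,X_n].$$ Consider the flat family of zero-dimensional elimination problems given by $G_1=0,\ldots,G_n=0$ and $F_n$, whose elimination polynomial is $$P_n=\prod_{j=0}^{2^n-1}\Bigl(Y-\bigl(j+T\prod_{i=1}^nU_i^{[j]_i}\bigr)\Bigr),$$ where $[j]_i$ is the $i$-th binary digit of $j$ (so $j=\sum_{i=1}^n[j]_i2^{i-1}$). Let $\mathcal{O}_n:=\{F_n^{(t,u)}:t\in\mathbb{A}^1,u\in\mathbb{A}^n\}$ be the input object class, encoded by $\omega_n:\mathbb{A}^1\times\mathbb{A}^n\to\mathcal{O}_n$, $\omega_n(t,u):=F_n^{(t,u)}$, and let $\mathcal{O}_n^*:=\{P_n^{(t,u)}:t\in\mathbb{A}^1,u\in\mathbb{A}^n\}$ be the output object class. Let $\mathcal{D}_n^*$ be a $\mathbb{Q}$-constructible output data structure of size $m_n^*$, let $\omega_n^*:\mathcal{D}_n^*\to\mathcal{O}_n^*$ be a $\mathbb{Q}$-definable holomorphic encoding, and let $\theta_n:\mathbb{A}^1\times\mathbb{A}^n\to\mathcal{D}_n^*$ be a totally division-free elimination procedure which solves the zero-dimensional elimination problem determined by $G_1,\ldots,G_n$ and $F_n$. Assume that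 the elimination procedure $\theta_n$ is robust. Then the size $m_n^*$ of the output data structure $\mathcal{D}_n^*$ satisfies the estimate $$m_n^*\ge 2^n.$$
   Context: $k=\mathbb{Q}$, $\overline{k}=\mathbb{C}$, $\mathbb{A}^m=\mathbb{C}^m$. For $t\in\mathbb{A}^1$, $u\in\mathbb{A}^n$, $F_n^{(t,u)}$ and $P_n^{(t,u)}$ denote the specializations of $F_n$ and $P_n$ at $T=t$, $U=u$; they are polynomials in $\mathbb{C}[X_1,\ldots,X_n]$ and $\mathbb{C}[Y]$, and are identified with their coefficient vectors, so $\mathcal{O}_n$ and $\mathcal{O}_n^*$ are $\mathbb{Q}$-constructible subsets of affine spaces. A $\mathbb{Q}$-constructible data structure of size $m$ is a $\mathbb{Q}$-constructible subset of $\mathbb{A}^m$ (finite boolean combination of zero sets of rational polynomials). A $\mathbb{Q}$-definable holomorphic encoding of a $\mathbb{Q}$-constructible object class is a surjective map from a data structure to the object class that is the restriction of a polynomial map with rational coefficients between the ambient affine spaces. The elimination polynomial of a flat family given by equations $G_i=0$ (defining a variety $V$ that is finite and generically unramified over the parameter space $\mathbb{A}^r$) and a polynomial $F$ is the minimal equation, monic in $Y$, of the image of $V$ under $z\mapsto(\pi(z),F(z))\in\mathbb{A}^{r+1}$, where $\pi$ is the projection to the parameter space. A totally division-free elimination procedure $\theta_n$ is given by polynomials $\theta_1,\ldots,\theta_{m_n^*}\in\mathbb{Q}[T,U]$ that define a map $\theta_n:\mathbb{A}^1\times\mathbb{A}^n\to\mathcal{D}_n^*$ with $\omega_n^*(\theta_n(t,u))=P_n^{(t,u)}$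 for all $(t,u)$ (with $P_n\in\mathbb{Q}[\theta_1,\ldots,\theta_{m_n^*}][Y]$). Robustness of $\theta_n$: since $G_1,\ldots,G_n$ do not depend on the parameters, an input object is $F_n^{(t,u)}$. Let $\mathcal{D}_{\theta_n}:=\{(\omega_n(t,u),\theta_n(t,u)):(t,u)\in\mathbb{A}^1\times\mathbb{A}^n\}$ with first projection $\mathcal{D}_{\theta_n}\to\mathcal{O}_n$. The procedure $\theta_n$ is robust if for every parameter point $(t,u)$, with $\mathfrak{m}$ the maximal ideal of $\mathbb{C}[\overline{\mathcal{O}}_n]$ defining the input object $F_n^{(t,u)}$, the localization $\mathbb{C}[\overline{\mathcal{D}}_{\theta_n}]_{\mathfrak{m}}$ (at the multiplicative set $\mathbb{C}[\overline{\mathcal{O}}_n]\setminus\mathfrak{m}$, via the first projection) is a finite $\mathbb{C}[\overline{\mathcal{O}}_n]_{\mathfrak{m}}$-module. Bars denote Zariski closures. *)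

(* Defs.v *)
From HB Require Import structures.
From mathcomp Require Import all_boot all_order all_algebra.
From mathcomp Require Import boolp classical_sets reals.
From mathcomp Require Import complex mpoly.

Set Implicit Arguments.
Unset Strict Implicit.
Unset Printing Implicit Defensive.

Import GRing.Theory Num.Theory.
Local Open Scope ring_scope.
Local Open Scope classical_set_scope.
Local Open Scope complex_scope.

Section AffineSpaces.
Variable R : realType.
Local Notation C := R[i].

(* C is the field of complex numbers; the affine space A^m is 'rV[C]_m. *)
Definition eval m (p : {mpoly C[m]}) (x : 'rV[C]_m) : C :=
  p.@[fun i => x 0 i].

Definition evalQ m (p : {mpoly rat[m]}) (x : 'rV[C]_m) : C :=
  eval (map_mpoly ratr p) x.

Definition polymapQ m N (h : 'I_N -> {mpoly rat[m]}) (x : 'rV[C]_m) :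
  'rV[C]_N := \row_j evalQ (h j) x.

Inductive Q_constructible m : set 'rV[C]_m -> Prop :=
| Qc_zeros (p : {mpoly rat[m]}) : Q_constructible [set x | evalQ p x = 0]
| Qc_compl A : Q_constructible A -> Q_constructible (~` A)
| Qc_inter A B :
    Q_constructible A -> Q_constructible B -> Q_constructible (A `&` B).

(* The values of omega outside the data structure D are irrelevant. *)
Definition Q_holomorphic_encoding m N (D : set 'rV[C]_m) (O : set 'rV[C]_N)
    (omega : 'rV[C]_m -> 'rV[C]_N) : Prop :=
  omega @` D = O /\
  exists h : 'I_N -> {mpoly rat[m]},
    forall d, D d -> omega d = polymapQ h d.

Definition zariski_closure m (S : set 'rV[C]_m) : set 'rV[C]_m :=
  [set x | forall p : {mpoly C[m]},
     (forall y, S y -> eval p y = 0) -> eval p x = 0].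

(* Equality in the coordinate ring C[closure of S] of the classes of the
   polynomials p and q. *)
Definition coord_eq m (S : set 'rV[C]_m) (p q : {mpoly C[m]}) : Prop :=
  forall x, zariski_closure S x -> eval p x = eval q x.

(* The comorphism of the first projection A^(N + m) -> A^N. *)
Definition pullback N m (a : {mpoly C[N]}) : {mpoly C[N + m]} :=
  a \mPo [tuple 'X_(lshift m i) | i < N].

End AffineSpaces.

Section EliminationProblem.
Variable R : realType.
Local Notation C := R[i].
Variables r n : nat.

(* Polynomials of Q[parameters, X] are elements of Q[parameters][X]. *)
Definition specialize (F : {mpoly {mpoly rat[r]}[n]}) (p : 'rV[C]_r) :
  {mpoly C[n]} := map_mpoly (fun c => evalQ c p) F.

Definition specialize1 (P : {poly {mpoly rat[r]}}) (p : 'rV[C]_r) :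
  {poly C} := map_poly (fun c => evalQ c p) P.

Variable G : 'I_n -> {mpoly {mpoly rat[r]}[n]}.

(* The variety V in A^r x A^n; the projection pi onto A^r is lsubmx. *)
Definition solutions : set 'rV[C]_(r + n) :=
  [set z | forall i, eval (specialize (G i) (lsubmx z)) (rsubmx z) = 0].

(* C[V] is a finite C[A^r]-module via pi. *)
Definition finite_over_parameters : Prop :=
  exists (k : nat) (b : 'I_k -> {mpoly C[r + n]}),
  forall g : {mpoly C[r + n]}, exists a : 'I_k -> {mpoly C[r]},
    coord_eq solutions g (\sum_(j < k) pullback n (a j) * b j).

(* Jacobian criterion, over a nonempty principal open subset of A^r. *)
Definition generically_unramified : Prop :=
  exists2 delta : {mpoly C[r]}, delta != 0 &
  forall z, solutions z -> eval delta (lsubmx z) != 0 ->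
    \det (\matrix_(i < n, j < n)
            eval (specialize (mderiv j (G i)) (lsubmx z)) (rsubmx z)) != 0.

Definition elimination_family : Prop :=
  finite_over_parameters /\ generically_unramified.

Definition elimination_image (F : {mpoly {mpoly rat[r]}[n]}) :
  set ('rV[C]_r * C) :=
  [set (lsubmx z, eval (specialize F (lsubmx z)) (rsubmx z))
     | z in solutions].

(* P is monic in Y and generates the ideal of all the equations of the
   hypersurface elimination_image F. *)
Definition elimination_polynomial (F : {mpoly {mpoly rat[r]}[n]})
    (P : {poly {mpoly rat[r]}}) : Prop :=
  let vanishes (Q : {poly {mpoly rat[r]}}) := forall w,
    elimination_image F w -> (specialize1 Q w.1).[w.2] = 0 in
  [/\ P \is monic, vanishes P &
      forall Q, vanishes Q -> exists S, Q = S * P].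

End EliminationProblem.

Section Localization.
Variable R : realType.
Local Notation C := R[i].
Variables N m : nat.
Variables (D : set 'rV[C]_(N + m)) (o : 'rV[C]_N).

(* D lies over an object class O in A^N with o \in O.  Elements of C[closure
   of O] and C[closure of D] are represented by polynomials; a polynomial
   represents an element of the maximal ideal m of o iff it vanishes at o.
   The class O itself is not needed: C[A^N] acts on C[closure of D] through
   its quotient C[closure of O]. *)
Definition outside_ideal (s : {mpoly C[N]}) : Prop := eval s o != 0.

(* An element a/q of C[closure of O]_m, resp. g/s of C[closure of D]_m, is
   represented by the pair (a, q), resp. (g, s), with outside_ideal of the
   second component. *)
Definition loc_eq (x y : {mpoly C[N + m]} * {mpoly C[N]}) : Prop :=
  exists2 s : {mpoly C[N]}, outside_ideal s &
    coord_eq D (pullback m s * (pullback m y.2 * x.1))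
               (pullback m s * (pullback m x.2 * y.1)).

Definition loc_add (x y : {mpoly C[N + m]} * {mpoly C[N]}) :
  {mpoly C[N + m]} * {mpoly C[N]} :=
  (pullback m y.2 * x.1 + pullback m x.2 * y.1, x.2 * y.2).

Definition loc_scale (a : {mpoly C[N]} * {mpoly C[N]})
    (x : {mpoly C[N + m]} * {mpoly C[N]}) :
  {mpoly C[N + m]} * {mpoly C[N]} :=
  (pullback m a.1 * x.1, a.2 * x.2).

(* C[closure of D]_m is a finite C[closure of O]_m-module. *)
Definition finite_localization : Prop :=
  exists (k : nat) (b : 'I_k -> {mpoly C[N + m]} * {mpoly C[N]}),
    (forall j, outside_ideal (b j).2) /\
    forall x : {mpoly C[N + m]} * {mpoly C[N]}, outside_ideal x.2 ->
    exists2 a : 'I_k -> {mpoly C[N]} * {mpoly C[N]},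
      forall j, outside_ideal (a j).2 &
      loc_eq x (\big[loc_add/(0, 1)]_(j < k) loc_scale (a j) (b j)).

End Localization.

Section Procedures.
Variable R : realType.
Local Notation C := R[i].
Variable r : nat.

(* Coefficient vector of a polynomial of degree at most e in n variables,
   indexed by the monomials of degree at most e. *)
Definition mcoef_vector n e (F : {mpoly C[n]}) :
  'rV[C]_#|{: 'X_{1..n < e.+1}}| := \row_k F@_(enum_val k : 'X_{1..n < e.+1}).

(* Coefficient vector of a univariate polynomial of degree at most e. *)
Definition coef_vector e (P : {poly C}) : 'rV[C]_e.+1 := \row_(k < e.+1) P`_k.

(* P is the elimination polynomial, of degree e in Y. *)
Definition division_free_procedure e m (P : {poly {mpoly rat[r]}})
    (D : set 'rV[C]_m) (omega : 'rV[C]_m -> 'rV[C]_e.+1)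
    (theta : 'I_m -> {mpoly rat[r]}) : Prop :=
  [/\ forall p, D (polymapQ theta p),
      forall p, omega (polymapQ theta p) = coef_vector e (specialize1 P p) &
      forall k, exists h : {mpoly rat[m]},
        P`_k = h \mPo [tuple theta i | i < m]].

(* omega maps a parameter point to the input object which it encodes; D lies
   over the object class [range omega]. *)
Definition robust N m (omega : 'rV[C]_r -> 'rV[C]_N)
    (theta : 'I_m -> {mpoly rat[r]}) : Prop :=
  let D := range (fun p => row_mx (omega p) (polymapQ theta p)) in
  forall p, finite_localization D (omega p).

End Procedures.

Section ProductFamily.
Variable n : nat.

(* The parameter space is A^(1 + n): T is the first coordinate, followed by
   U_1, ..., U_n.  Indices i < n are 0-based. *)
Definition parT : {mpoly rat[1 + n]} := 'X_(lshift n ord0).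
Definition parU (i : 'I_n) : {mpoly rat[1 + n]} := 'X_(rshift 1 i).

Definition G_ (i : 'I_n) : {mpoly {mpoly rat[1 + n]}[n]} := 'X_i ^+ 2 - 'X_i.

Definition F_ : {mpoly {mpoly rat[1 + n]}[n]} :=
  \sum_(i < n) (2 ^ i)%:R * 'X_i
  + parT%:MP * \prod_(i < n) (1 + (parU i - 1)%:MP * 'X_i).

Definition digit (j i : nat) : nat := (j %/ 2 ^ i) %% 2.

Definition P_ : {poly {mpoly rat[1 + n]}} :=
  \prod_(j < 2 ^ n)
    ('X - (j%:R + parT * \prod_(i < n) parU i ^+ digit j i)%:P).

Variable R : realType.
Local Notation C := R[i].

(* F_ has degree at most n in X and P_ has degree 2 ^ n in Y. *)
Definition input_encoding (p : 'rV[C]_(1 + n)) :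
  'rV[C]_#|{: 'X_{1..n < n.+1}}| := mcoef_vector n (specialize F_ p).

Definition input_class : set 'rV[C]_#|{: 'X_{1..n < n.+1}}| :=
  range input_encoding.

Definition output_class : set 'rV[C]_(2 ^ n).+1 :=
  range (fun p : 'rV[C]_(1 + n) => coef_vector (2 ^ n) (specialize1 P_ p)).

End ProductFamily.

Arguments G_ n i : clear implicits.
Arguments input_encoding n R p : clear implicits.
Arguments input_class n R : clear implicits.
Arguments output_class n R : clear implicits.

(* Main.v *)
Require Import Defs.
From HB Require Import structures.
From mathcomp Require Import all_boot all_order all_algebra.
From mathcomp Require Import boolp classical_sets reals.
From mathcomp Require Import complex mpoly.

(** The lower bound rests on a singularity of the family at T = 0.  All the
    parameter points (0, u) encode the same input object, namely
    sum_i 2^(i-1) X_i, whereas the direction in which the output P_n leaves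
    its value at T = 0 still depends on u, and fills a space of dimension 2^n.

    Robustness forces the value of theta at (0, u) to be independent of u.
    Above the single input object at T = 0, a finite localization makes all
    the powers of one output coordinate y combinations, with constant
    coefficients, of the same k functions.  Hence k + 1 of these powers are
    linearly dependent, and y is a root of a nonzero one-variable polynomial g
    ([fibre_algebraic]).  Now theta_i(0, s u) is a polynomial in s whose values
    are all roots of g, so it is constant ([theta_const]).  Write v0 for the
    common value.

    Division-freeness says that P_n(l) is a polynomial H_l in theta, for each
    l < 2^n.  Differentiating in T at 0, the chain rule expresses
    dP_n(l)/dT (0, u) as the product of the row of partial derivatives of H_l
    at v0, which no longer involves u, by the column dtheta/dT (0, u) of
    height m.  On the other hand P_n(l) is the product of the factors
    l - j - T prod_i U_i^[j]_i, of which only j = l vanishes at T = 0, so the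
    same derivative equals - prod_i u_i^[l]_i * prod_(j != l) (l - j)
    ([deriv_P]).  At u_i = a^(2^(i-1)) the monomial becomes a^l, and letting a
    range over 0, ..., 2^n - 1 one obtains an invertible diagonal matrix times
    a Vandermonde matrix.  This matrix of rank 2^n factors through C^m, whence
    2^n <= m ([size_bound]).

    The statements on the family itself come from the description of the
    solutions as A^r times the vertices of the cube {0, 1}^n, indexed by
    j < 2^n through binary digits ([solutionsP]).  The coordinate ring is
    generated, as a module over the parameters, by the Lagrange idempotents of the
    2^n vertices, the Jacobian is diagonal with entries 1 or -1, and F_n takes at
    the vertex j the value which is the j-th root of P_n.  An equation of the
    image of (pi, F_n) therefore has these 2^n distinct roots in the domain
    Q[T, U], so its remainder modulo the monic P_n is zero. *)

Set Implicit Arguments.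
Unset Strict Implicit.
Unset Printing Implicit Defensive.

Import Order.TTheory GRing.Theory Num.Theory.
Local Open Scope ring_scope.
Local Open Scope classical_set_scope.
Local Open Scope complex_scope.

(** * Polynomials that vanish everywhere *)

Lemma poly_vanishing (K : numDomainType) (p : {poly K}) :
  (forall x, p.[x] = 0) -> p = 0.
Proof.
move=> p0; pose rs := [seq i%:R : K | i <- iota 0 (size p)].
apply: (@roots_geq_poly_eq0 _ p rs).
- by apply/allP => x _; apply/rootP.
- by rewrite map_inj_uniq ?iota_uniq //; apply: mulrIn; rewrite oner_eq0.
- by rewrite size_map size_iota.
Qed.

(** If the values of q are roots of g, then g \Po q vanishes everywhere, which
    is impossible when q is not constant: the degrees multiply. *)
Lemma poly_algebraic_const (K : numDomainType) (g q : {poly K}) :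
  g != 0 -> (forall s, g.[q.[s]] = 0) -> forall s t, q.[s] = q.[t].
Proof.
move=> g_nz gq s t; suff /size1_polyC-> : (size q <= 1)%N by rewrite !hornerC.
rewrite leqNgt; apply: contra g_nz => q_gt1.
have : g \Po q == 0 by apply/eqP/poly_vanishing => x; rewrite horner_comp.
by rewrite comp_poly_eq0.
Qed.

(** The map [muni] singles out the last variable.  This and the next lemma make
    it usable for inductions on the number of variables. *)
Lemma meval_muni (K : comNzRingType) n (p : {mpoly K[n.+1]})
    (v : 'I_n.+1 -> K) :
  p.@[v] =
  (map_poly (meval (v \o widen_ord (leqnSn n))) (muni p)).[v ord_max].
Proof.
rewrite mevalE muniE rmorph_sum horner_sum; apply: eq_bigr => m _ /=.
rewrite !map_polyZ map_polyXn !hornerZ hornerXn /=.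
rewrite mevalZ -mulrA; congr (_ * _).
rewrite mevalX big_ord_recr /=; congr (_ * _).
by apply: eq_bigr => i _; rewrite mnmE.
Qed.

Lemma mcoeff_muni (K : nzRingType) n (p : {mpoly K[n.+1]}) m :
  p@_m =
  (muni p)`_(m ord_max)@_[multinom m (widen_ord (leqnSn n) i) | i < n].
Proof.
rewrite muniE coef_sum raddf_sum /= [in LHS](mpolyE p) raddf_sum /=.
apply: eq_bigr => m' _; rewrite !coefZ coefXn mcoeffZ mcoeffX.
have [max_eq|max_ne] := eqVneq (m ord_max) (m' ord_max); last first.
  rewrite mulr0 mcoeff0; have [Em|] := eqVneq m' m; last by rewrite mulr0.
  by rewrite Em eqxx in max_ne.
rewrite mulr1 mcoeffZ mcoeffX; congr (_ * _%:R); congr nat_of_bool.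
apply/eqP/eqP => [->//|/mnmP eq_widen]; apply/mnmP => i.
have [j ->|->] := unliftP ord_max i; last by rewrite max_eq.
have -> : lift ord_max j = widen_ord (leqnSn n) j.
  by apply: val_inj; rewrite /= /bump leqNgt ltn_ord.
by have := eq_widen j; rewrite !mnmE.
Qed.

Lemma mpoly_vanishing (K : numDomainType) n (p : {mpoly K[n]}) :
  (forall v, p.@[v] = 0) -> p = 0.
Proof.
elim: n p => [|n IHn] p p0.
  have pE : p = (p@_0%MM)%:MP.
    apply/mpolyP => m; have -> : m = 0%MM by apply/mnmP => -[].
    by rewrite mcoeffC eqxx mulr1.
  by have := p0 (fun=> 0); rewrite pE mevalC => ->.
suff muni0 : muni p = 0.
  by apply/mpolyP => m; rewrite mcoeff_muni muni0 coef0 !mcoeff0.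
apply/polyP => k; rewrite coef0; apply: IHn => v.
pose w (x : K) (i : 'I_n.+1) := if unlift ord_max i is Some j then v j else x.
have wE x : w x \o widen_ord (leqnSn n) =1 v.
  move=> i; rewrite /= /w; have -> : widen_ord (leqnSn n) i = lift ord_max i.
    by apply: val_inj; rewrite /= /bump leqNgt ltn_ord.
  by rewrite liftK.
rewrite -coef_map; have -> : map_poly (meval v) (muni p) = 0.
  apply: poly_vanishing => x; rewrite -[RHS](p0 (w x)) meval_muni.
  have -> : w x ord_max = x by rewrite /w unlift_none.
  by rewrite (eq_map_poly (fun q => meval_eq q (wE x))).
by rewrite coef0.
Qed.

(** * Derivatives of multivariate polynomials *)

Lemma mderivXU (A : comNzRingType) m (i k : 'I_m) :
  mderiv k ('X_i : {mpoly A[m]}) = (k == i)%:R.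
Proof.
rewrite mderivX mnm1E eq_sym; case: eqP => [->|_]; last by rewrite scale0r.
by rewrite -{1}[U_(i)%MM]add0m addmK scale1r mpolyX0.
Qed.

(** The chain rule along a polynomial curve c.  The polynomials that satisfy
    it contain the constants and the variables, and are closed under products
    and sums. *)
Lemma deriv_mmap (A K : comNzRingType) m (f : {rmorphism A -> {poly K}})
    (c : 'I_m -> {poly K}) (p : {mpoly A[m]}) :
  (forall a, (f a)^`() = 0) ->
  (mmap f c p)^`() = \sum_i mmap f c (mderiv i p) * (c i)^`().
Proof.
move=> f0.
pose chain (q : {mpoly A[m]}) :=
  (mmap f c q)^`() = \sum_i mmap f c (mderiv i q) * (c i)^`().
have chainC a : chain a%:MP.
  by rewrite /chain mmapC f0 big1 // => i _; rewrite mderivC mmap0 mul0r.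
have chainM q1 q2 : chain q1 -> chain q2 -> chain (q1 * q2).
  rewrite /chain => e1 e2; rewrite rmorphM derivM e1 e2 mulr_suml mulr_sumr.
  rewrite -big_split; apply: eq_bigr => i _.
  by rewrite mderivM raddfD /= !rmorphM /= mulrDl mulrAC [in X in _ + X]mulrA.
have chainX i : chain 'X_i.
  rewrite /chain mmapX mmap1U (bigD1 i) //= mderivXU eqxx rmorph1 mul1r.
  rewrite big1 ?addr0 // => j ne_ji.
  by rewrite mderivXU (negPf ne_ji) rmorph0 mul0r.
have chain_term a mon : chain (a *: 'X_[mon]).
  rewrite -mul_mpolyC; apply: (chainM) => //.
  rewrite mpolyXE_id; apply: (big_ind chain _ chainM) => [|i _].
    by have := chainC 1.
  elim: (mon i) => [|e IHe]; first by rewrite expr0; have := chainC 1.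
  by rewrite exprS; apply: chainM.
rewrite -/(chain p); elim/mpolyind: p => [|a mon q _ _ IHq].
  by have := chainC 0; rewrite mpolyC0.
rewrite /chain !raddfD /= IHq chain_term -big_split; apply: eq_bigr => i _.
by rewrite mderivD raddfD mulrDl.
Qed.

(** * Evaluation at complex points *)

Section Evaluation.
Variable R : realType.
Local Notation C := R[i].

Lemma evalM m (p q : {mpoly C[m]}) x : eval (p * q) x = eval p x * eval q x.
Proof. exact: mevalM. Qed.

Lemma evalD m (p q : {mpoly C[m]}) x : eval (p + q) x = eval p x + eval q x.
Proof. exact: mevalD. Qed.

Lemma eval_sum m I (r : seq I) (P : pred I) (F : I -> {mpoly C[m]}) x :
  eval (\sum_(i <- r | P i) F i) x = \sum_(i <- r | P i) eval (F i) x.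
Proof. exact: raddf_sum. Qed.

Lemma eval_prod m I (r : seq I) (P : pred I) (F : I -> {mpoly C[m]}) x :
  eval (\prod_(i <- r | P i) F i) x = \prod_(i <- r | P i) eval (F i) x.
Proof. exact: rmorph_prod. Qed.

Lemma eval_pullback N m (a : {mpoly C[N]}) (z : 'rV[C]_(N + m)) :
  eval (pullback m a) z = eval a (lsubmx z).
Proof.
rewrite /eval /pullback comp_mpoly_meval; apply: meval_eq => i.
by rewrite tnth_mktuple mevalXU mxE.
Qed.

Lemma eval_pullbackM N m (a : {mpoly C[N]}) g (z : 'rV[C]_(N + m)) :
  eval (pullback m a * g) z = eval a (lsubmx z) * eval g z.
Proof. by rewrite evalM eval_pullback. Qed.

Lemma sub_zariski_closure m (S : set 'rV[C]_m) x : S x -> zariski_closure S x.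
Proof. by move=> Sx p; apply. Qed.

Lemma coord_eq_on m (S : set 'rV[C]_m) (p q : {mpoly C[m]}) :
  (forall x, S x -> eval p x = eval q x) -> coord_eq S p q.
Proof.
move=> eq_pq x Sx; apply/eqP; rewrite -subr_eq0 -mevalB; apply/eqP.
by apply: Sx => y Sy; apply/eqP; rewrite /eval mevalB subr_eq0; apply/eqP/eq_pq.
Qed.

Lemma meval_map_mpoly (A B : comNzRingType) (f : {rmorphism A -> B}) n v
    (p : {mpoly A[n]}) :
  (map_mpoly f p).@[v] = mmap f v p.
Proof.
rewrite /map_mpoly /mmap rmorph_sum; apply: eq_bigr => m _ /=.
rewrite rmorphM /= mevalC rmorph_prod; congr (_ * _).
by apply: eq_bigr => i _; rewrite rmorphXn /= mevalXU.
Qed.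

(** [evalQ] with its arguments exchanged, so that evaluation at a fixed point
    is the head constant of a ring morphism. *)
Definition evalQ_at r (x : 'rV[C]_r) (p : {mpoly rat[r]}) : C := evalQ p x.

HB.instance Definition _ r (x : 'rV[C]_r) :=
  GRing.RMorphism.copy (evalQ_at x)
    (meval (fun i => x 0 i) \o map_mpoly (ratr : rat -> C)).

Lemma evalQE r (x : 'rV[C]_r) (p : {mpoly rat[r]}) :
  evalQ p x = mmap (ratr : rat -> C) (fun i => x 0 i) p.
Proof. exact: meval_map_mpoly. Qed.

Lemma evalQ0 r (x : 'rV[C]_r) : evalQ 0 x = 0.
Proof. exact: (rmorph0 (evalQ_at x)). Qed.

Lemma evalQX r (x : 'rV[C]_r) i : evalQ 'X_i x = x 0 i.
Proof. by rewrite evalQE mmapX mmap1U. Qed.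

Lemma evalQ_vanishing r (p : {mpoly rat[r]}) :
  (forall x : 'rV[C]_r, evalQ p x = 0) -> p = 0.
Proof.
move=> p0; apply: mpoly_vanishing => v; apply: (fmorph_inj (@ratr C)).
rewrite rmorph0 -(p0 (\row_i ratr (v i))) evalQE /meval /mmap rmorph_sum /=.
apply: eq_bigr => m _; rewrite rmorphM rmorph_prod; congr (_ * _).
by apply: eq_bigr => i _; rewrite mxE rmorphXn.
Qed.

Lemma specializeE r k (F : {mpoly {mpoly rat[r]}[k]}) (p : 'rV[C]_r) :
  specialize F p = map_mpoly (evalQ_at p) F.
Proof. by []. Qed.

End Evaluation.

(** * Binary digits *)

Lemma sum_digit n j : (\sum_(i < n) digit j i * 2 ^ i)%N = (j %% 2 ^ n)%N.
Proof.
elim: n => [|n IHn]; first by rewrite big_ord0 modn1.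
rewrite big_ord_recr /= IHn /digit modn_divl -expnS.
by rewrite [RHS](divn_eq _ (2 ^ n)) modn_dvdm ?expnS ?dvdn_mull // addnC.
Qed.

Lemma digit_bool j i : digit j i = (digit j i == 1%N) :> nat.
Proof.
have := ltn_pmod (j %/ 2 ^ i) (isT : 0 < 2)%N.
by rewrite /digit; case: (_ %% 2)%N => [|[]].
Qed.

Lemma digit_inj n (j k : 'I_(2 ^ n)) :
  (forall i : 'I_n, digit j i = digit k i) -> j = k.
Proof.
move=> eq_jk; apply: val_inj.
rewrite -[LHS](modn_small (ltn_ord j)) -[RHS](modn_small (ltn_ord k)).
by rewrite -!sum_digit; apply: eq_bigr => i _; rewrite eq_jk.
Qed.

(** By counting: j |-> (digits of j) is an injection between two sets of
    cardinal 2^n. *)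
Lemma digit_surj n (e : 'I_n -> bool) :
  exists j : 'I_(2 ^ n), forall i : 'I_n, digit j i = e i.
Proof.
pose bits (j : 'I_(2 ^ n)) := [ffun i : 'I_n => digit j i == 1%N].
have bits_inj : injective bits.
  move=> j k /ffunP eq_jk; apply: digit_inj => i.
  have := eq_jk i; rewrite !ffunE => eq_bit.
  by rewrite digit_bool [in RHS]digit_bool eq_bit.
have [] := inj_card_bij bits_inj; first by rewrite card_ffun card_bool !card_ord.
move=> inv _ invK; exists (inv (finfun e)) => i.
have /ffunP/(_ i) := invK (finfun e).
by rewrite !ffunE => <-; apply: digit_bool.
Qed.

Lemma prod_exp_digit (A : comNzRingType) n (a : A) (l : 'I_(2 ^ n)) :
  \prod_(i < n) (a ^+ (2 ^ i)) ^+ digit l i = a ^+ l.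
Proof.
rewrite -[in RHS](modn_small (ltn_ord l)) -sum_digit -prodrXr.
by apply: eq_bigr => i _; rewrite -exprM mulnC.
Qed.

(** * The flat family and its elimination polynomial *)

Section Family.
Variable R : realType.
Local Notation C := R[i].
Variable n : nat.

Definition vertex (j : nat) : 'rV[C]_n := \row_i (digit j i)%:R.

(** The j-th root of P_n, which is also the value of F_n at the j-th vertex. *)
Definition vertex_value (j : nat) : {mpoly rat[1 + n]} :=
  j%:R + parT n * \prod_(i < n) parU i ^+ digit j i.

Lemma P_E : P_ n = \prod_(j < 2 ^ n) ('X - (vertex_value j)%:P).
Proof. by []. Qed.

Lemma eval_G (p : 'rV[C]_(1 + n)) (x : 'rV[C]_n) i :
  eval (specialize (G_ n i) p) x = x 0 i ^+ 2 - x 0 i.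
Proof.
rewrite specializeE /G_ rmorphB rmorphXn /= map_mpolyX /eval mevalB.
by rewrite rmorphXn /= mevalXU.
Qed.

Lemma solutionsP (z : 'rV[C]_((1 + n) + n)) :
  solutions (G_ n) z <-> exists j : 'I_(2 ^ n), rsubmx z = vertex j.
Proof.
split=> [z0|[j zj] i]; last first.
  by rewrite eval_G zj mxE digit_bool; case: eqP; rewrite ?expr1n ?expr0n subrr.
have [j jE] := digit_surj (fun i => rsubmx z 0 i == 1).
exists j; apply/rowP => i; rewrite [in RHS]mxE jE.
have /eqP := z0 i; rewrite eval_G; set x := rsubmx z 0 i.
rewrite -[X in _ - X]mulr1 expr2 -mulrBr mulf_eq0 subr_eq0.
by case/orP => /eqP ->; rewrite ?eqxx // eq_sym oner_eq0.
Qed.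

Lemma eval_F (p : 'rV[C]_(1 + n)) (j : 'I_(2 ^ n)) :
  eval (specialize (F_ n) p) (vertex j) = evalQ (vertex_value j) p.
Proof.
rewrite specializeE /F_ rmorphD rmorphM rmorph_sum rmorph_prod /=.
rewrite /eval mevalD mevalM map_mpolyC mevalC [X in X + _]raddf_sum.
rewrite [X in _ + _ * X = _]rmorph_prod /=.
rewrite -[RHS]/(evalQ_at p (vertex_value j)).
rewrite rmorphD rmorphM rmorph_prod rmorph_nat /=.
congr (_ + _ * _).
  rewrite -[X in _ = X%:R](modn_small (ltn_ord j)) -sum_digit natr_sum.
  apply: eq_bigr => i _; rewrite !rmorphM !rmorph_nat /= map_mpolyX mevalXU mxE.
  by rewrite mulrC.
apply: eq_bigr => i _.
rewrite rmorphD rmorph1 rmorphM /= map_mpolyC map_mpolyX.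
rewrite mevalD meval1 mevalM mevalC mevalXU mxE /= rmorphB rmorph1 rmorphXn /=.
rewrite digit_bool.
by case: eqP => _; rewrite ?mulr1 ?mulr0 ?addr0 // addrC subrK.
Qed.

(** On the solutions, g agrees with the sum over the vertices j of the
    restriction of g to the j-th sheet, a polynomial in the parameters, times
    the Lagrange idempotent of the vertex j. *)
Lemma finite_over_parameters_G : finite_over_parameters R (G_ n).
Proof.
pose bit (j : 'I_(2 ^ n)) (i : 'I_n) : {mpoly C[(1 + n) + n]} :=
  if digit j i == 1%N then 'X_(rshift (1 + n) i)
  else 1 - 'X_(rshift (1 + n) i).
exists (2 ^ n)%N, (fun j => \prod_i bit j i) => g.
pose a (j : 'I_(2 ^ n)) := g \mPo [tuple match split i with
  | inl k => 'X_k
  | inr k => ((digit j k)%:R : C)%:MP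
  end | i < (1 + n) + n].
exists a; apply: coord_eq_on => z /solutionsP[j zj].
have bitE k : eval (\prod_i bit k i) z = (k == j)%:R.
  have bitv i : eval (bit k i) z = (digit k i == digit j i)%:R.
    have zE : z 0 (rshift (1 + n) i) = (digit j i)%:R.
      by have /rowP/(_ i) := zj; rewrite !mxE.
    rewrite /bit; case: ifP => ki; rewrite /eval ?mevalB ?meval1 mevalXU zE;
      rewrite (digit_bool j) (digit_bool k) ki; case: eqP => //= _.
      by rewrite subrr.
    by rewrite subr0.
  rewrite eval_prod; have [eq_kj|ne_kj] := eqVneq k j.
    by rewrite big1 // => i _; rewrite bitv eq_kj eqxx.
  case: (pickP (fun i : 'I_n => digit k i != digit j i)) => [i ne_i|eq_kj].
    by rewrite (bigD1 i) //= bitv (negPf ne_i) mul0r.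
  case/eqP: ne_kj; apply: digit_inj => i.
  by apply/eqP; have := eq_kj i; move/negbFE.
rewrite eval_sum (bigD1 j) //= [X in _ + X]big1 => [|k ne_kj]; last first.
  by rewrite evalM bitE (negPf ne_kj) mulr0.
rewrite addr0 evalM bitE eqxx mulr1 eval_pullback.
rewrite /a /eval comp_mpoly_meval; apply: meval_eq => i; rewrite tnth_mktuple.
case: splitP => k ik.
  by rewrite mevalXU mxE; congr (z 0 _); apply: val_inj.
have /rowP/(_ k) := zj; rewrite mevalC !mxE => <-.
by congr (z 0 _); apply: val_inj.
Qed.

Lemma mderiv_G i k :
  mderiv k (G_ n i) = if k == i then 'X_i *+ 2 - 1 else 0.
Proof.
rewrite /G_ expr2 mderivB mderivM mderivXU.
by case: eqP => _; rewrite ?mul1r ?mulr1 ?mul0r ?mulr0 ?addr0 ?subr0 ?mulr2n.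
Qed.

Lemma generically_unramified_G : generically_unramified R (G_ n).
Proof.
(* The Jacobian determinant vanishes nowhere: delta = 1 will do. *)
exists 1; first exact: oner_neq0.
move=> z /solutionsP[j zj] _; rewrite det_trig; last first.
  apply/is_trig_mxP => i k lt_ik; rewrite mxE mderiv_G -val_eqE gtn_eqF //.
  by rewrite specializeE rmorph0 /eval meval0.
apply/prodf_neq0 => i _.
rewrite mxE mderiv_G eqxx specializeE rmorphB rmorphMn rmorph1 /=.
rewrite map_mpolyX /eval mevalB mevalMn mevalXU meval1 zj mxE digit_bool.
case: (digit j i == 1%N); first by rewrite mulr2n addrK oner_eq0.
by rewrite mul0rn sub0r oppr_eq0 oner_eq0.
Qed.

Lemma horner_prod_XsubC_root (A : comNzRingType) N (f : 'I_N -> A) j :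
  (\prod_(k < N) ('X - (f k)%:P)).[f j] = 0.
Proof. by rewrite horner_prod (bigD1 j) //= hornerXsubC subrr mul0r. Qed.

(** The roots of P_n are told apart by their values j at T = 0. *)
Lemma vertex_value_inj : injective vertex_value.
Proof.
have value0 j : evalQ (vertex_value j) (0 : 'rV[C]_(1 + n)) = j%:R.
  rewrite -[LHS]/(evalQ_at _ _) rmorphD rmorphM rmorph_nat /=.
  by rewrite [evalQ_at _ _]evalQX mxE mul0r addr0.
by move=> j k eq_jk; apply/eqP; rewrite -(eqr_nat C) -!value0 eq_jk.
Qed.

(** The ring Q[T, U] is a domain but not a field, so divisibility by P_n is
    obtained by dividing by a monic polynomial: the remainder has 2^n distinct
    roots and degree less than 2^n. *)
Lemma elimination_polynomial_P :
  elimination_polynomial R (G_ n) (F_ n) (P_ n).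
Proof.
have monP : P_ n \is monic by rewrite P_E monic_prod_XsubC.
have P_root (j : 'I_(2 ^ n)) : (P_ n).[vertex_value j] = 0.
  by rewrite P_E (horner_prod_XsubC_root (fun j : 'I_(2 ^ n) => vertex_value j)).
have imageP (p : 'rV[C]_(1 + n)) (j : 'I_(2 ^ n)) :
    elimination_image (G_ n) (F_ n) (p, evalQ (vertex_value j) p).
  exists (row_mx p (vertex j)); last by rewrite row_mxKl row_mxKr eval_F.
  by apply/solutionsP; exists j; rewrite row_mxKr.
have horner_value Q (p : 'rV[C]_(1 + n)) (c : {mpoly rat[1 + n]}) :
    (specialize1 Q p).[evalQ c p] = evalQ Q.[c] p.
  exact: (horner_map (evalQ_at p)).
split=> // [w [z /solutionsP[j zj] <-]|Q Q0] /=.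
  by rewrite zj eval_F horner_value P_root evalQ0.
exists (Pdiv.CommonRing.rdivp Q (P_ n)).
rewrite [LHS](Pdiv.RingMonic.rdivp_eq monP).
set r := Pdiv.CommonRing.rmodp _ _.
suff -> : r = 0 by rewrite addr0.
have rE : r = Q - Pdiv.CommonRing.rdivp Q (P_ n) * P_ n.
  apply/eqP; rewrite eq_sym subr_eq addrC; apply/eqP.
  exact: Pdiv.RingMonic.rdivp_eq.
apply: (@roots_geq_poly_eq0 _ r [seq vertex_value j | j <- iota 0 (2 ^ n)]).
- apply/allP => x /mapP[j]; rewrite mem_iota /= => lt_j {x}->.
  apply/rootP; apply: (@evalQ_vanishing R) => p.
  have := Q0 _ (imageP p (Ordinal lt_j)).
  rewrite horner_value rE hornerD hornerN hornerM.
  by rewrite (P_root (Ordinal lt_j)) mulr0 subr0.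
- by rewrite map_inj_uniq ?iota_uniq //; apply: vertex_value_inj.
- rewrite size_map size_iota -ltnS.
  have -> : (2 ^ n).+1 = size (P_ n).
    by rewrite P_E size_prod_XsubC /index_enum -enumT size_enum_ord.
  by rewrite Pdiv.CommonRing.ltn_rmodpN0 // monic_neq0.
Qed.

Lemma input_encoding_holomorphic :
  Q_holomorphic_encoding setT (input_class n R) (input_encoding n R).
Proof.
split=> //; exists (fun k => (F_ n)@_(enum_val k : 'X_{1..n < n.+1})) => p _.
by apply/rowP => k; rewrite !mxE specializeE mcoeff_map_mpoly.
Qed.

End Family.

(** * Fibres of a finite localization *)

Section Fibre.
Variable R : realType.
Local Notation C := R[i].

(** On the fibre over o, a fraction of the base is a constant.  Finiteness
    therefore expresses all the powers of y there as constant combinations of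
    the same k functions, and k + 1 of them are linearly dependent. *)
Lemma fibre_algebraic N m (D : set 'rV[C]_(N + m)) (o : 'rV[C]_N)
    (y : {mpoly C[N + m]}) :
  finite_localization D o ->
  exists2 g : {poly C}, g != 0 &
    forall x, D x -> lsubmx x = o -> g.[eval y x] = 0.
Proof.
move=> [k [b [b_out b_gen]]].
pose comb (a : 'I_k -> {mpoly C[N]} * {mpoly C[N]}) :=
  \big[@loc_add R N m/(0, 1)]_(j < k) loc_scale (a j) (b j).
have one_out : outside_ideal o 1 by rewrite /outside_ideal /eval meval1 oner_eq0.
have /boolp.choice[a aP] e : exists a : 'I_k -> {mpoly C[N]} * {mpoly C[N]},
    (forall j, outside_ideal o (a j).2) /\ loc_eq D o (y ^+ e, 1) (comb a).
  by have [a a_out aE] := b_gen (y ^+ e, 1) one_out; exists a.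
pose frac (q : {mpoly C[N]} * {mpoly C[N]}) := eval q.1 o / eval q.2 o.
pose M := \matrix_(e < k.+1, j < k) frac (a e j).
have [w w_nz wM] : exists2 w : 'rV_k.+1, w != 0 & w *m M = 0.
  have : kermx M != 0.
    by rewrite kermx_eq0 /row_free neq_ltn (leq_ltn_trans (rank_leq_col M)).
  by case/rowV0Pn=> w /sub_kermxP wM w_nz; exists w.
exists (rVpoly w).
  by apply: contra w_nz => /eqP w0; rewrite -[w]rVpolyK w0 linear0.
move=> x Dx xo.
pose val (q : {mpoly C[N + m]} * {mpoly C[N]}) := eval q.1 x / eval q.2 o.
have combE e : outside_ideal o (comb (a e)).2 /\
    val (comb (a e)) = \sum_(j < k) frac (a e j) * val (b j).
  have [a_out _] := aP e; rewrite /comb.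
  elim/big_rec2: _ => [|j v q _ [q_out qE]].
    by split=> //; rewrite /val /= /eval meval0 mul0r.
  have ab_out : eval (a e j).2 o * eval (b j).2 o != 0.
    by rewrite mulf_neq0 ?b_out ?a_out.
  split; first by rewrite /outside_ideal /= evalM [X in X * _]evalM mulf_neq0.
  rewrite -qE /val /frac /loc_add /loc_scale.
  case: (a e j) (b j) q q_out ab_out {qE}
    => [a1 a2] [b1 b2] [q1 q2] /= q_out ab_out.
  rewrite evalD !eval_pullbackM xo.
  rewrite [eval (a2 * b2) o]evalM [eval (_ * q2) o]evalM [eval (a2 * b2) o]evalM.
  by rewrite mulf_div addf_div //; congr ((_ + _) / _); exact: mulrC.
have powE e : eval y x ^+ e = \sum_(j < k) frac (a e j) * val (b j).
  have [out <-] := combE e; have [_ [s s_out /(_ x)]] := aP e.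
  move=> /(_ (sub_zariski_closure Dx)).
  rewrite !eval_pullbackM xo => /(mulfI s_out) /=.
  rewrite [eval 1 o]meval1 mul1r [eval (y ^+ e) x]rmorphXn => yE.
  by rewrite /val -yE mulrAC divff // mul1r.
rewrite horner_poly.
transitivity (\sum_(e < k.+1) w 0 e * eval y x ^+ e).
  apply: eq_bigr => e _; rewrite insubT //= => lt_e.
  by congr (w 0 _ * _); apply: val_inj.
transitivity (\sum_(j < k) (w *m M) 0 j * val (b j)); last first.
  by rewrite wM big1 // => j _; rewrite mxE mul0r.
under eq_bigr => e _ do rewrite powE mulr_sumr.
rewrite exchange_big /=; apply: eq_bigr => j _.
by rewrite mxE mulr_suml; apply: eq_bigr => e _; rewrite mxE mulrA.
Qed.

End Fibre.

(** * Curves in the parameter space *)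

Section Curves.
Variable R : realType.
Local Notation C := R[i].

Definition along r (c : 'I_r -> {poly C}) : {mpoly rat[r]} -> {poly C} :=
  mmap (polyC \o (ratr : rat -> C)) c.

HB.instance Definition _ r (c : 'I_r -> {poly C}) :=
  GRing.RMorphism.copy (along c) (mmap (polyC \o (ratr : rat -> C)) c).

Lemma alongX r (c : 'I_r -> {poly C}) i : along c 'X_i = c i.
Proof. by rewrite /along mmapX mmap1U. Qed.

Lemma horner_along r (c : 'I_r -> {poly C}) q s :
  (along c q).[s] = evalQ q (\row_i (c i).[s]).
Proof.
rewrite evalQE /along /mmap horner_sum; apply: eq_bigr => e _.
rewrite hornerM hornerC /mmap1 horner_prod; congr (_ * _).
by apply: eq_bigr => i _; rewrite horner_exp mxE.
Qed.

Lemma along_comp r m (c : 'I_r -> {poly C}) (theta : 'I_m -> {mpoly rat[r]}) H :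
  along c (H \mPo [tuple theta i | i < m]) =
  along (fun i => along c (theta i)) H.
Proof.
rewrite /comp_mpoly [in RHS]/along /mmap rmorph_sum; apply: eq_bigr => e _ /=.
rewrite rmorphM /= [X in X * _]mmapC; congr (_ * _).
rewrite /mmap1 rmorph_prod; apply: eq_bigr => i _.
by rewrite rmorphXn /= tnth_mktuple.
Qed.

Lemma deriv_along_comp r m (c : 'I_r -> {poly C})
    (theta : 'I_m -> {mpoly rat[r]}) H s :
  (along c (H \mPo [tuple theta i | i < m]))^`().[s] =
  \sum_i evalQ (mderiv i H) (polymapQ theta (\row_i (c i).[s]))
         * (along c (theta i))^`().[s].
Proof.
rewrite along_comp [along _ H]/along deriv_mmap => [|q]; last by rewrite derivC.
rewrite horner_sum; apply: eq_bigr => i _; rewrite hornerM; congr (_ * _).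
rewrite -/(along _ _) horner_along; congr evalQ.
by apply/rowP => j; rewrite !mxE horner_along.
Qed.

Variable n : nat.

Definition point (t : C) (u : 'I_n -> C) : 'rV[C]_(1 + n) :=
  row_mx t%:M (\row_i u i).

(** The line s |-> (s, u), transversal to T = 0. *)
Definition tline (u : 'I_n -> C) (i : 'I_(1 + n)) : {poly C} :=
  if split i is inr k then (u k)%:P else 'X.

(** The line s |-> (0, s u), which joins (0, 0) to (0, u) inside T = 0. *)
Definition uline (u : 'I_n -> C) (i : 'I_(1 + n)) : {poly C} :=
  if split i is inr k then u k *: 'X else 0.

Lemma tlineE u t : \row_i (tline u i).[t] = point t u.
Proof.
apply/rowP => i; rewrite !mxE /tline; case: splitP => k _; rewrite !mxE.
  by rewrite hornerX ord1.
by rewrite hornerC.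
Qed.

Lemma ulineE u s : \row_i (uline u i).[s] = point 0 (fun k => u k * s).
Proof.
apply/rowP => i; rewrite !mxE /uline; case: splitP => k _; rewrite !mxE.
  by rewrite hornerC mul0rn.
by rewrite hornerZ hornerX.
Qed.

Lemma input_encoding_T0 u u' :
  input_encoding n R (point 0 u) = input_encoding n R (point 0 u').
Proof.
suff FE v : specialize (F_ n) (point 0 v) = \sum_(i < n) (2 ^ i)%:R * 'X_i.
  by rewrite /input_encoding !FE.
rewrite specializeE /F_ rmorphD rmorphM /= rmorph_sum map_mpolyC /=.
have -> : evalQ_at (point 0 v) (parT n) = 0.
  by rewrite [LHS]evalQX mxE; case: splitP => // k _; rewrite mxE mul0rn.
rewrite mpolyC0 mul0r addr0; apply: eq_bigr => i _.
by rewrite rmorphM rmorph_nat /= map_mpolyX.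
Qed.

Lemma along_tline_value u j :
  along (tline u) (vertex_value n j) =
  j%:R + (\prod_(i < n) u i ^+ digit j i) *: 'X.
Proof.
rewrite /vertex_value rmorphD rmorphM rmorph_nat rmorph_prod /=.
rewrite [along _ (parT n)]alongX.
rewrite {1}/tline (_ : split (lshift n ord0) = inl ord0); last first.
  by rewrite -[lshift n ord0]/(unsplit (inl ord0)) unsplitK.
congr (_ + _); rewrite -mul_polyC mulrC rmorph_prod; congr (_ * _).
apply: eq_bigr => i _; rewrite !rmorphXn /= [along _ (parU i)]alongX /tline.
by rewrite -[rshift 1 i]/(unsplit (inr i)) unsplitK.
Qed.

(** Only the factor of index l of P_n(l) vanishes at T = 0, so only its
    derivative contributes. *)
Lemma deriv_P (u : 'I_n -> C) (l : 'I_(2 ^ n)) :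
  (along (tline u) (P_ n).[l%:R])^`().[0] =
  - (\prod_(i < n) u i ^+ digit l i) * \prod_(j < 2 ^ n | j != l) (l%:R - j%:R).
Proof.
have -> : (P_ n).[l%:R] = \prod_(j < 2 ^ n) (l%:R - vertex_value n j).
  by rewrite P_E horner_prod; apply: eq_bigr => j _; exact: hornerXsubC.
rewrite rmorph_prod (bigD1 l) //= derivM hornerD !hornerM.
have fE j : along (tline u) (l%:R - vertex_value n j) =
    (l%:R - j%:R) - (\prod_(i < n) u i ^+ digit j i) *: 'X.
  by rewrite rmorphB rmorph_nat /= along_tline_value opprD addrA.
rewrite fE subrr sub0r derivN derivZ derivX !hornerN !hornerZ hornerX hornerC.
rewrite mulr0 mulr1 oppr0 mul0r addr0 horner_prod; congr (_ * _).
apply: eq_bigr => j _; rewrite fE hornerD hornerN hornerZ hornerX mulr0 subr0.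
by rewrite -!polyC_natr -polyCB hornerC.
Qed.

End Curves.

(** * The size of the output data structure *)

Section SizeBound.
Variable R : realType.
Local Notation C := R[i].
Variable n : nat.

(** The points (0, s u) all lie over one input object, so each coordinate of
    theta is algebraic over C along this line, hence constant. *)
Lemma theta_const m (theta : 'I_m -> {mpoly rat[1 + n]}) u u' :
  robust (input_encoding n R) theta ->
  polymapQ theta (point 0 u) = polymapQ theta (point 0 u') :> 'rV[C]_m.
Proof.
move=> rob.
suff to0 v : polymapQ theta (point 0 v) =
             polymapQ theta (point 0 (fun=> 0)) :> 'rV[C]_m.
  by rewrite to0 [RHS]to0.
apply/rowP => i; rewrite !mxE.
have [g g_nz g0] :=
  fibre_algebraic 'X_(rshift _ i) (rob (point 0 (fun=> 0))).
have lineE s : evalQ (theta i) (point 0 (fun k => v k * s)) =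
               (along (uline v) (theta i)).[s].
  by rewrite horner_along ulineE.
have -> : evalQ (theta i) (point 0 v) = (along (uline v) (theta i)).[1].
  by rewrite -lineE; congr (evalQ _ (point _ _)); apply: funext => k; rewrite mulr1.
have -> : evalQ (theta i) (point 0 (fun=> 0)) =
          (along (uline v) (theta i)).[0].
  by rewrite -lineE; congr (evalQ _ (point _ _)); apply: funext => k; rewrite mulr0.
apply: (poly_algebraic_const g_nz) => s; rewrite -lineE.
set p := point 0 _.
have := g0 (row_mx (input_encoding n R p) (polymapQ theta p)).
rewrite row_mxKl /eval mevalXU row_mxEr mxE; apply; first by exists p.
exact: input_encoding_T0.
Qed.

Lemma size_bound m (theta : 'I_m -> {mpoly rat[1 + n]}) :
  (forall k, exists h : {mpoly rat[m]},
     (P_ n)`_k = h \mPo [tuple theta i | i < m]) ->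
  robust (input_encoding n R) theta ->
  (2 ^ n <= m)%N.
Proof.
move=> Pcoef rob.
have /boolp.choice[H HE] (l : 'I_(2 ^ n)) : exists H : {mpoly rat[m]},
    (P_ n).[l%:R] = H \mPo [tuple theta i | i < m].
  have /boolp.choice[h hE] := Pcoef.
  exists (\sum_(k < size (P_ n)) h k * l%:R ^+ k).
  rewrite horner_coef rmorph_sum /=; apply: eq_bigr => k _.
  by rewrite rmorphM rmorphXn rmorph_nat /= hE.
(* This choice of u turns the multilinear monomials into the powers of a. *)
pose u (a : nat) (i : 'I_n) : C := a%:R ^+ (2 ^ i).
pose v0 : 'rV[C]_m := polymapQ theta (point 0 (u 0%N)).
pose J := \matrix_(l < 2 ^ n, i < m) evalQ (mderiv i (H l)) v0.
pose W := \matrix_(i < m, a < 2 ^ n) (along (tline (u a)) (theta i))^`().[0].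
pose c := \row_(l < 2 ^ n) - \prod_(j < 2 ^ n | j != l) (l%:R - j%:R : C).
pose V := Vandermonde (2 ^ n) (\row_(a < 2 ^ n) (a%:R : C)).
have JW : J *m W = diag_mx c *m V.
  apply/matrixP => l a; rewrite mul_diag_mx !mxE.
  have -> : - (\prod_(j < 2 ^ n | j != l) (l%:R - j%:R)) * a%:R ^+ l =
            (along (tline (u a)) (P_ n).[l%:R])^`().[0] :> C.
    by rewrite deriv_P prod_exp_digit !mulNr mulrC.
  rewrite HE deriv_along_comp; apply: eq_bigr => i _; rewrite !mxE tlineE.
  by congr (evalQ _ _ * _); apply: theta_const.
have rank_cV : \rank (diag_mx c *m V) = (2 ^ n)%N.
  apply/mxrank_unit; rewrite unitmxE det_mulmx det_diag det_Vandermonde.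
  rewrite unitrM !unitfE; apply/andP; split.
    apply/prodf_neq0 => l _; rewrite mxE oppr_eq0; apply/prodf_neq0 => j ne_jl.
    by rewrite subr_eq0 eqr_nat eq_sym.
  apply/prodf_neq0 => i _; apply/prodf_neq0 => j lt_ij.
  by rewrite !mxE subr_eq0 eqr_nat gtn_eqF.
by rewrite -rank_cV -JW mulmx_max_rank.
Qed.

End SizeBound.

Theorem theorem3 (R : realType) (n : nat) :
  [/\ elimination_family R (G_ n),
      elimination_polynomial R (G_ n) (F_ n) (P_ n),
      Q_holomorphic_encoding setT (input_class n R) (input_encoding n R) &
      forall (m : nat) (D : set 'rV[R[i]]_m)
             (omega : 'rV[R[i]]_m -> 'rV[R[i]]_(2 ^ n).+1)
             (theta : 'I_m -> {mpoly rat[1 + n]}),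
        Q_constructible D ->
        Q_holomorphic_encoding D (output_class n R) omega ->
        division_free_procedure (P_ n) D omega theta ->
        robust (input_encoding n R) theta ->
        (2 ^ n <= m)%N].
Proof.
split.
- by split; [apply: finite_over_parameters_G | apply: generically_unramified_G].
- exact: elimination_polynomial_P.
- exact: input_encoding_holomorphic.
- by move=> m D omega theta _ _ [_ _ Pcoef]; apply: size_bound.
Qed.
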